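(* A graph $G$ is an R-cocore if and only if $G$ has property N*.
   Context: Graphs are finite, undirected and without loops. For a graph $H$, a finite set $B$ and a relation $R\subseteq V_H\times B$ with full image (every $b\in B$ has some $v\in V_H$ with $(v,b)\in R$), $H\ast R$ denotes the graph with vertex set $B$ and edge set $\{(a,b)\in B\times B:\ \text{there is } (u,v)\in E_H \text{ with } (u,a)\in R,\ (v,b)\in R\}$. All relations are required to have full domain (every $v\in V_H$ has some $b\in B$ with $(v,b)\in R$). Let $H$ be a subgraph of $G$. An R-coretraction of $H$ to $G$ is a relation $R\subseteq V_H\times V_G$ such that $H\ast R=G$ and $(x,x)\in R$ for all $x\in V_H$; in this case $H$ is called an R-coretract of $G$. A graph $G$ is an R-cocore if there is no proper subgraph of $G$ that is an R-coretract of $G$. $N_G(x)$ is the set of vertices adjacent to $x$ in $G$. $G$ has property N* if, for every vertex $x\in V_G$, there is no subset $U_x\subseteq V_G\setminus\{x\}$ such that $N_G(x)=\bigcup_{y\in U_x}N_G(y)$.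
   Formalization: Subgraphs are taken to be induced (with arbitrary subgraphs the path on four vertices has N* but is not an R-cocore), and the sets U_x in property N* are taken to be nonempty (otherwise the one-vertex graph is an R-cocore without N* ). *)

(* Defs.v *)
From mathcomp Require Import all_boot.

Set Implicit Arguments.
Unset Strict Implicit.
Unset Printing Implicit Defensive.

Record sgraph := SGraph {
  vertex :> finType;
  adj : rel vertex;
  adj_sym : symmetric adj;
  adj_irrefl : irreflexive adj
}.

Definition nbhd (G : sgraph) (x : G) : {set G} := [set y | adj x y].

Section Induced.
Variables (G : sgraph) (S : {set G}).

Definition induced_adj : rel {x : G | x \in S} := [rel x y | adj (val x) (val y)].

Lemma induced_sym : symmetric induced_adj.
Proof. by move=> x y; exact: adj_sym. Qed.

Lemma induced_irrefl : irreflexive induced_adj.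
Proof. by move=> x; exact: adj_irrefl. Qed.

(* The induced subgraph G[S]; the map [val] includes its vertices into G. *)
Definition induced : sgraph := SGraph induced_sym induced_irrefl.
End Induced.

Section Relations.
Variables (V B : finType) (R : {set V * B}).

Definition full_domain := forall v : V, exists b : B, (v, b) \in R.
Definition full_image := forall b : B, exists v : V, (v, b) \in R.
End Relations.

(* The edge relation of H * R, whose vertex set is the whole of B. It is only a
   [rel], not an [sgraph], because H * R may have loops even if H has none. *)
Definition star_adj (H : sgraph) (B : finType) (R : {set H * B}) : rel B :=
  [rel a b | [exists u : H, exists v : H,
     [&& adj u v, (u, a) \in R & (v, b) \in R]]].

(* R is an R-coretraction of the subgraph G[S] to G. *)
Definition R_coretraction (G : sgraph) (S : {set G})
    (R : {set induced S * G}) : Prop :=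
  [/\ full_domain R, full_image R, star_adj R =2 @adj G
    & forall x : induced S, (x, val x) \in R].

Definition R_coretract (G : sgraph) (S : {set G}) : Prop :=
  exists R : {set induced S * G}, R_coretraction R.

(* Subgraphs are taken to be induced, so a subgraph is given by its vertex set
   and is proper when that set is. With arbitrary subgraphs the path with edges
   12, 23, 34 would not be an R-cocore: its spanning subgraph with edges 12, 34
   gives the path back under R = id + (1,3). Yet the path has property N*. *)
Definition R_cocore (G : sgraph) : Prop :=
  ~ exists S : {set G}, S \proper [set: G] /\ R_coretract S.

(* The family U is nonempty: an empty union would make every isolated vertex a
   violation, including the one of the one-vertex graph, which is an R-cocore
   since relations have full image. *)
Definition property_Nstar (G : sgraph) : Prop :=
  forall x : G, ~ exists U : {set G},
    [/\ U != set0, U \subset [set~ x] & nbhd x = \bigcup_(y in U) nbhd y].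

(* Main.v *)
Require Import Defs.
From mathcomp Require Import all_boot.

(** If N(x) is the union of the N(y), y in U, then id together with U x {x} is
    an R-coretraction of G - x to G; the new relation creates no loop at x, as an
    edge inside U would put x in N(x). Conversely, let R be an R-coretraction of
    G[S] to G and x a vertex outside S. Reachability under R, restricted to S,
    preserves the edges of G[S], because (G[S]) * R restricted to S is G[S]; so
    N(x) is the union of the N(u), u ranging over the vertices of S that reach
    an R-predecessor of x. *)

Set Implicit Arguments.
Unset Strict Implicit.
Unset Printing Implicit Defensive.

Section Star.
Variables (H : sgraph) (B : finType) (R : {set H * B}).

Lemma star_adjP a b :
  reflect (exists u v : H, [/\ adj u v, (u, a) \in R & (v, b) \in R])
          (star_adj R a b).
Proof.
apply: (iffP existsP) => -[u].
  by case/existsP=> v /and3P[]; exists u, v.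
by case=> v [uv ua vb]; exists u; apply/existsP; exists v; apply/and3P.
Qed.

Lemma star_adjC a b : star_adj R a b = star_adj R b a.
Proof.
by apply/star_adjP/star_adjP => -[u [v [uv ua vb]]];
  exists v, u; rewrite adj_sym.
Qed.

End Star.

Section DeletedVertex.
Variables (G : sgraph) (x : G) (U : {set G}).
Hypotheses (Un0 : U != set0) (Ux : U \subset [set~ x])
  (NxE : nbhd x = \bigcup_(y in U) nbhd y).

Definition blowup : {set induced [set~ x] * G} :=
  [set p | (val p.1 == p.2) || (p.2 == x) && (val p.1 \in U)].

Lemma adj_coverP b : reflect (exists2 u, u \in U & adj u b) (adj x b).
Proof.
have -> : adj x b = (b \in nbhd x) by rewrite inE.
rewrite NxE; apply: (iffP bigcupP) => -[u uU]; last by exists u; rewrite ?inE.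
by rewrite inE; exists u.
Qed.

Lemma cover_sub u b : u \in U -> adj u b -> adj x b.
Proof. by move=> uU ub; apply/adj_coverP; exists u. Qed.

(** The edge [xb] comes from an edge [ub] with [u] in [U]: [u] is sent to [x], while [b], distinct
    from [x] by irreflexivity, is sent to itself. *)
Lemma blowup_adj_cover b : adj x b -> star_adj blowup x b.
Proof.
move=> xb; have [u uU ub] := adj_coverP b xb.
have bNx : b \in [set~ x].
  by rewrite !inE; apply: contraTneq xb => ->; rewrite adj_irrefl.
apply/star_adjP; exists (Sub u (subsetP Ux u uU)), (Sub b bNx).
by split=> //; rewrite !inE /= ?uU !eqxx ?orbT.
Qed.

Lemma blowup_star : star_adj blowup =2 @adj G.
Proof.
move=> a b; apply/idP/idP.
  case/star_adjP=> u [v []]; rewrite /= !inE /= => uv.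
  case/orP=> [/eqP <-|/andP[/eqP-> uU]]; case/orP=> [/eqP <-|/andP[/eqP-> vU]] //.
  - by rewrite adj_sym; apply: cover_sub vU _; rewrite adj_sym.
  - exact: cover_sub uU _.
  (* Both ends go to [x], so the goal is the loop [adj x x]: the edge [uv] makes [v] a neighbour of
     [x], and then [v] in [U] makes [x] one too. *)
  - have xv := cover_sub uU uv.
    by apply: (cover_sub vU); rewrite adj_sym.
have [->|ax] := eqVneq a x; first exact: blowup_adj_cover.
have [->|bx] := eqVneq b x.
  by rewrite adj_sym star_adjC; exact: blowup_adj_cover.
move=> ab; have aS : a \in [set~ x] by rewrite !inE.
have bS : b \in [set~ x] by rewrite !inE.
apply/star_adjP; exists (Sub a aS), (Sub b bS).
by split=> //; rewrite !inE eqxx.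
Qed.

Lemma blowup_coretraction : R_coretraction blowup.
Proof.
have diag (u : induced [set~ x]) : (u, val u) \in blowup by rewrite !inE eqxx.
split=> // [u|b|]; [by exists (val u) | | exact: blowup_star].
have [->|bx] := eqVneq b x.
  (* Only a member of [U] can be sent to [x]. *)
  have [u uU] := set0Pn _ Un0.
  by exists (Sub u (subsetP Ux u uU)); rewrite !inE /= uU eqxx orbT.
have bS : b \in [set~ x] by rewrite !inE.
by exists (Sub b bS); rewrite !inE /= eqxx.
Qed.

End DeletedVertex.

Section Coretraction.
Variables (G : sgraph) (S : {set G}) (R : {set induced S * G}).
Hypothesis RS : R_coretraction R.

Definition reach : rel (induced S) := connect [rel u v | (u, val v) \in R].

Lemma coretraction_adj (u v : induced S) a b :
  adj u v -> (u, a) \in R -> (v, b) \in R -> adj a b.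
Proof.
have [_ _ RE _] := RS => uv ua vb; rewrite -RE.
by apply/star_adjP; exists u, v.
Qed.

(** Each step of the path moves one end of the edge, while [v] stays in place because [(v, val v)]
    is in [R]. *)
Lemma reach_adj (u w v : induced S) : reach u w -> adj u v -> adj w v.
Proof.
have [_ _ _ Rid] := RS.
case/connectP=> p; elim: p u => [|t p IHp] u /=; first by move=> _ ->.
case/andP=> ut tp lastw uv; apply: IHp tp lastw _.
exact: coretraction_adj uv ut (Rid v).
Qed.

Lemma coretraction_cover x : x \notin S ->
  exists U : {set G},
    [/\ U != set0, U \subset [set~ x] & nbhd x = \bigcup_(y in U) nbhd y].
Proof.
have [_ Rim RE Rid] := RS => xS.
pose U := [set val u | u : induced S & [exists w, reach u w && ((w, x) \in R)]].
have memU (u : induced S) : (u, x) \in R -> val u \in U.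
  move=> ux; apply: imset_f; rewrite inE; apply/existsP; exists u.
  by rewrite ux /reach connect0.
exists U; split.
- by have [u ux] := Rim x; apply/set0Pn; exists (val u); exact: memU.
- apply/subsetP=> _ /imsetP[u _ ->]; rewrite !inE.
  by apply: contraNneq xS => <-; exact: (valP u).
apply/setP=> y; rewrite inE -RE; apply/idP/bigcupP.
  (* Sending [u] to itself instead of to [x] turns the edge [xy] into an edge from [u] to [y]. *)
  case/star_adjP=> u [v [uv ux vy]]; exists (val u); first exact: memU.
  by rewrite inE; exact: coretraction_adj uv (Rid u) vy.
case=> _ /imsetP[u + ->]; rewrite !inE => /existsP[w /andP[uw wx]].
(* As [y] may lie outside [S], its edge to [u] is first pulled back to an edge [u'v] inside [S],
   where [reach_adj] applies; the resulting edge [wv] is then mapped to [xy]. *)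
rewrite -RE => /star_adjP[u' [v [u'v u'u vy]]].
have u'w : reach u' w by apply: connect_trans (connect1 _) uw.
by apply/star_adjP; exists w, v; rewrite wx vy (reach_adj u'w u'v).
Qed.

End Coretraction.

Theorem proposition4p4p10 (G : sgraph) : R_cocore G <-> property_Nstar G.
Proof.
split=> [cocore x [U [Un0 Ux NxE]]|Nstar [S [/properP[_ [x _ xS]] [R RS]]]].
  apply: cocore; exists [set~ x]; split.
    by rewrite properT; apply/eqP=> /setP/(_ x); rewrite !inE eqxx.
  by exists (blowup x U); exact: blowup_coretraction.
exact: Nstar x (coretraction_cover RS xS).
Qed.
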